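(* Let $H$ be the free group on $\{a_2,b_2\}$ and $G=\langle\alpha,\beta\mid\beta\alpha=\alpha^{-1}\beta\rangle$, with action $\varphi\colon G\to\mathrm{Aut}(H)$ given by $\varphi(\alpha)(a_2)=a_2$, $\varphi(\alpha)(b_2)=a_2^{-2}b_2$, $\varphi(\beta)(a_2)=a_2^{-1}$, $\varphi(\beta)(b_2)=a_2b_2a_2$, so that $P_2(\mathbb{K})\cong H\rtimes_\varphi G$ (with $\alpha=a_1a_2$, $\beta=b_2b_1$). Then for all $n\geq2$, $$\Gamma_n(P_2(\mathbb{K}))=N_n\rtimes_\varphi\langle\alpha^{2^{n-1}}\rangle,$$ where $N_n$ is the normal closure in $H$ of $\{a_2^{2^{n-1}}\}\cup\{x^{2^{n-i}} : x\in\Gamma_i(H),\ 2\leq i\leq n\}$. Consequently $P_2(\mathbb{K})$ is residually nilpotent.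
   Context: $\mathbb{K}$ is the Klein bottle, $P_2(\mathbb{K})$ its 2-string pure braid group; $H$ corresponds to $\pi_1(\mathbb{K}\setminus\{x_1\})$, the kernel of forgetting the second string. $\Gamma_1(G)=G$, $\Gamma_{i+1}(G)=[\Gamma_i(G),G]$; a group is residually nilpotent iff $\bigcap_i\Gamma_i=\{1\}$. *)

(* Defs.v *)
From mathcomp Require Import all_boot all_order all_algebra.
Set Implicit Arguments. Unset Strict Implicit. Unset Printing Implicit Defensive.
Import GRing.Theory Num.Theory.

Record Grp := MkGrp {
  gcar :> Type;
  gmul : gcar -> gcar -> gcar;
  ginv : gcar -> gcar;
  gone : gcar }.

Arguments gmul {_} _ _.
Arguments ginv {_} _.
Arguments gone {_}.

Inductive gen (G : Grp) (S : G -> Prop) : G -> Prop :=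
  | gen_base x : S x -> gen S x
  | gen_one : gen S gone
  | gen_mul x y : gen S x -> gen S y -> gen S (gmul x y)
  | gen_inv x : gen S x -> gen S (ginv x).

Definition gcomm (G : Grp) (x y : G) : G := gmul (gmul (ginv x) (ginv y)) (gmul x y).
Definition gconj (G : Grp) (s x : G) : G := gmul (gmul (ginv x) s) x.
Fixpoint gpow (G : Grp) (x : G) (n : nat) : G :=
  match n with 0 => gone | S k => gmul x (gpow x k) end.

(* lower central series: Gamma_1 = G, Gamma_{i+1} = [Gamma_i, G]
   (index 0 is given the harmless value G as well) *)
Fixpoint lcs (G : Grp) (n : nat) : G -> Prop :=
  match n with
  | 0 => fun _ => True
  | S m => match m with
           | 0 => fun _ => True
           | S _ => gen (fun z => exists x y, @lcs G m x /\ z = gcomm x y)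
           end
  end.

Definition normal_closure (G : Grp) (S : G -> Prop) : G -> Prop :=
  gen (fun z => exists s x, S s /\ z = gconj s x).

Definition residually_nilpotent (G : Grp) : Prop :=
  forall x : G, (forall i, @lcs G i x) -> x = gone.

(* a letter (g, e): g = false for a2, true for b2; e = true means inverse *)
Definition letter := (bool * bool)%type.
Definition inv_l (x : letter) : letter := (x.1, ~~ x.2).
Definition cons_red (x : letter) (w : seq letter) : seq letter :=
  if w is y :: w' then (if y == inv_l x then w' else x :: w) else [:: x].
Definition reduced (w : seq letter) : bool := sorted (fun x y => y != inv_l x) w.

Lemma cons_red_reduced x w : reduced w -> reduced (cons_red x w).
Proof.
case: w => [|y w] //=; case: eqP => [_|/eqP ne] /=.
  by rewrite /reduced; apply: path_sorted.
by rewrite /reduced /= ne.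
Qed.

Lemma foldr_red_reduced s w : reduced w -> reduced (foldr cons_red w s).
Proof. by elim: s => [|x s IH] //= rw; apply: cons_red_reduced; apply: IH. Qed.

Definition FG := {w : seq letter | reduced w}.
Definition red_app (s : seq letter) (v : FG) : FG :=
  exist _ (foldr cons_red (sval v) s) (foldr_red_reduced s (svalP v)).
Definition fg_one : FG := exist _ [::] isT.
Definition fg_mul (u v : FG) : FG := red_app (sval u) v.
Definition fg_inv (u : FG) : FG := red_app (rev (map inv_l (sval u))) fg_one.
Definition FreeGrp : Grp := MkGrp fg_mul fg_inv fg_one.

Definition a2 : FreeGrp := exist _ [:: (false, false)] isT.
Definition b2 : FreeGrp := exist _ [:: (true, false)] isT.

Definition fsubst (ia ib : FG) (u : FG) : FG :=
  foldr (fun x acc => let y := if x.1 then ib else ia in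
                      fg_mul (if x.2 then fg_inv y else y) acc) fg_one (sval u).

Definition phiA : FG -> FG := fsubst a2 (fg_mul (fg_inv (fg_mul a2 a2)) b2).
Definition phiAinv : FG -> FG := fsubst a2 (fg_mul (fg_mul a2 a2) b2).
Definition phiB : FG -> FG := fsubst (fg_inv a2) (fg_mul a2 (fg_mul b2 a2)).

(* ---------- G = < alpha, beta | beta alpha = alpha^-1 beta >,
   in normal form: (m, n) stands for alpha^m beta^n ---------- *)
Local Open Scope ring_scope.
Definition KG := (int * int)%type.
Definition ksign (n : int) (m : int) : int := if odd `|n|%N then - m else m.
Definition kmul (g h : KG) : KG := (g.1 + ksign g.2 h.1, g.2 + h.2).
Definition kinv (g : KG) : KG := (- ksign g.2 g.1, - g.2).
Definition kone : KG := (0, 0).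
Definition KleinGrp : Grp := MkGrp kmul kinv kone.
Definition alpha : KleinGrp := (1, 0).
Definition beta : KleinGrp := (0, 1).

(* the action phi : G -> Aut(H), phi(alpha^m beta^n) = phi(alpha)^m o phi(beta)^n *)
Definition phi (g : KG) (h : FG) : FG :=
  iter `|g.1|%N (if 0 <= g.1 then phiA else phiAinv)
       (if odd `|g.2|%N then phiB h else h).

Definition pmul (x y : FG * KG) : FG * KG := (fg_mul x.1 (phi x.2 y.1), kmul x.2 y.2).
Definition pinv (x : FG * KG) : FG * KG :=
  (phi (kinv x.2) (fg_inv x.1), kinv x.2).
Definition P2K : Grp := MkGrp pmul pinv (fg_one, kone).

Definition Nn (n : nat) : FreeGrp -> Prop :=
  normal_closure (fun y : FreeGrp =>
    y = gpow a2 (2 ^ (n - 1)) \/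
    exists (i : nat) (x : FreeGrp),
      (2 <= i <= n)%N /\ @lcs FreeGrp i x /\ y = gpow x (2 ^ (n - i))).

(* Main.v *)
(* For a group H let E(i, d) be the subgroup generated by the 2^(i + d - j)-th
   powers of the elements of Gamma_j(H), i <= j <= i + d.  From
   [u^2, h] = [u, h]^2 [[u, h], u]^[u, h] one gets by induction on d that
   [E(i, d), H] <= E(i + 1, d) and that squares of E(i, d) lie in E(i, d + 1).
   For the free group this yields that N_n / N_(n+1) is central in H / N_(n+1)
   and of exponent 2.  An automorphism of H which is trivial modulo N_2 and maps
   a2 to a2 or its inverse then acts trivially on N_n / N_(n+1), so the subgroups
   on the right-hand side form a central series of P_2(K).  Conversely
   Gamma_j(P_2(K)) / Gamma_(j+1)(P_2(K)) has exponent 2 for j >= 2, because the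
   commutators of the generators a2, b2, alpha, beta have squares in Gamma_3.

   For residual nilpotence, Sanov's faithful representation of the free group
   by [[1,2],[0,1]] and [[1,0],[2,1]] sends N_n to matrices congruent to 1
   modulo 2^n. *)
Require Import Defs.
From mathcomp Require Import all_boot all_order all_algebra zify ring.
Set Implicit Arguments. Unset Strict Implicit. Unset Printing Implicit Defensive.

(** * Group laws on the bare structure, and identities valid in every group *)

Class group_laws (G : Grp) : Prop := {
  gmulA : forall x y z : G, gmul x (gmul y z) = gmul (gmul x y) z;
  gmul1g : forall x : G, gmul gone x = x;
  gmulVg : forall x : G, gmul (ginv x) x = gone }.

Section Laws.
Context {G : Grp} {LG : group_laws G}.
Implicit Types x y z : G.

Lemma gmulKg x y : gmul (ginv x) (gmul x y) = y.
Proof. by rewrite gmulA gmulVg gmul1g. Qed.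

Lemma gmul_inj x y z : gmul x y = gmul x z -> y = z.
Proof. by move=> e; rewrite -(gmulKg x y) e gmulKg. Qed.

Lemma gmulg1 x : gmul x gone = x.
Proof. by apply: (@gmul_inj (ginv x)); rewrite gmulA gmulVg gmul1g. Qed.

Lemma gmulgV x : gmul x (ginv x) = gone.
Proof. by apply: (@gmul_inj (ginv x)); rewrite gmulA gmulVg gmul1g gmulg1. Qed.

Lemma gmulKVg x y : gmul x (gmul (ginv x) y) = y.
Proof. by rewrite gmulA gmulgV gmul1g. Qed.

Lemma ginvK x : ginv (ginv x) = x.
Proof. by apply: (@gmul_inj (ginv x)); rewrite gmulgV gmulVg. Qed.

Lemma ginvM x y : ginv (gmul x y) = gmul (ginv y) (ginv x).
Proof.
by apply: (@gmul_inj (gmul x y)); rewrite gmulgV -gmulA gmulKVg gmulgV.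
Qed.

Lemma ginv1 : ginv gone = gone :> G.
Proof. by rewrite -[LHS]gmul1g gmulgV. Qed.

Lemma gmul_assoc_right x y z : gmul (gmul x y) z = gmul x (gmul y z).
Proof. by rewrite gmulA. Qed.

End Laws.

(* Decides identities valid in every group, by computing reduced words. *)
Ltac group_id := rewrite /gcomm /gconj; repeat first
  [ rewrite gmul_assoc_right | rewrite ginvM | rewrite ginvK | rewrite ginv1
  | rewrite gmul1g | rewrite gmulg1 | rewrite gmulKg | rewrite gmulKVg
  | rewrite gmulVg | rewrite gmulgV ]; try done.

Class normal (G : Grp) (K : G -> Prop) : Prop := {
  nrm1 : K gone;
  nrmM : forall x y, K x -> K y -> K (gmul x y);
  nrmV : forall x, K x -> K (ginv x);
  nrmJ : forall x g, K x -> K (gconj x g) }.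

(** * Generators, commutators and squares modulo a normal subgroup; the subgroups E(i, d) *)

Section Generic.
Context {G : Grp} {LG : group_laws G}.
Implicit Types (x y z g h : G) (S K : G -> Prop).

Lemma gen_sub S T : (forall x, S x -> gen T x) -> forall x, gen S x -> gen T x.
Proof.
move=> ST x; elim=> {x} [x /ST //||x y _ Tx _ Ty|x _ Tx].
- exact: gen_one.
- exact: gen_mul.
- exact: gen_inv.
Qed.

Lemma gen_normal S :
  (forall x g, S x -> gen S (gconj x g)) -> normal (gen S).
Proof.
move=> SJ; split; [exact: gen_one | exact: gen_mul | exact: gen_inv |].
move=> x g; elim=> {x} [x /SJ //||x y _ Tx _ Ty|x _ Tx].
- have -> : gconj gone g = gone by group_id.
  exact: gen_one.
- have -> : gconj (gmul x y) g = gmul (gconj x g) (gconj y g) by group_id.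
  exact: gen_mul.
- have -> : gconj (ginv x) g = ginv (gconj x g) by group_id.
  exact: gen_inv.
Qed.

Lemma gen_in S K {nK : normal K} : (forall x, S x -> K x) -> forall x, gen S x -> K x.
Proof.
move=> SK x; elim=> {x} [x /SK //||x y _ Tx _ Ty|x _ Tx].
- exact: nrm1.
- exact: nrmM.
- exact: nrmV.
Qed.

Lemma normal_closure_normal S : normal (normal_closure S).
Proof.
apply: gen_normal => x g [s [h [Ss ->]]]; apply: gen_base.
by exists s, (gmul h g); split=> //; group_id.
Qed.

Lemma normal_closure_base S x : S x -> normal_closure S x.
Proof. by move=> Sx; apply: gen_base; exists x, gone; split=> //; group_id. Qed.

Lemma normal_closure_in S K {nK : normal K} :
  (forall x, S x -> K x) -> forall x, normal_closure S x -> K x.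
Proof.
move=> SK; apply: gen_in => x [s [h [Ss ->]]]; apply: nrmJ; exact: SK.
Qed.

(** By [xy, h] = [x, h]^y [y, h] and the similar formula for x^-1, commutators need only be tested
    on generators. *)
Lemma gen_comm S K {nK : normal K} :
  (forall s h, S s -> K (gcomm s h)) -> forall x h, gen S x -> K (gcomm x h).
Proof.
move=> SK x h; elim=> {x} [x Sx||x y _ Kx _ Ky|x _ Kx].
- exact: SK.
- have -> : gcomm gone h = gone by group_id.
  exact: nrm1.
- have -> : gcomm (gmul x y) h = gmul (gconj (gcomm x h) y) (gcomm y h)
    by group_id.
  by apply: nrmM => //; exact: nrmJ.
- have -> : gcomm (ginv x) h = ginv (gconj (gcomm x h) (ginv x)) by group_id.
  by apply: nrmV; exact: nrmJ.
Qed.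

Lemma gcommC_in K x y {nK : normal K} : K (gcomm x y) -> K (gcomm y x).
Proof.
have -> : gcomm y x = ginv (gcomm x y) by group_id.
exact: nrmV.
Qed.

Lemma normal_closure_comm S K {nK : normal K} :
  (forall s h, S s -> K (gcomm s h)) ->
  forall x h, normal_closure S x -> K (gcomm x h).
Proof.
move=> SK; apply: gen_comm => _ h [s [g [Ss ->]]].
have -> : gcomm (gconj s g) h = gconj (gcomm s (gconj h (ginv g))) g by group_id.
by apply: nrmJ; apply: SK.
Qed.

(** From (xy)^2 = x^2 y^2 [y, x]^y: squaring is multiplicative on elements that commute modulo
    [K]. *)
Lemma sqM K x y {nK : normal K} : K (gcomm y x) -> K (gmul x x) -> K (gmul y y) ->
  K (gmul (gmul x y) (gmul x y)).
Proof.
move=> Kyx Kx Ky.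
have -> : gmul (gmul x y) (gmul x y) =
  gmul (gmul (gmul x x) (gmul y y)) (gconj (gcomm y x) y) by group_id.
by apply: nrmM; [apply: nrmM | apply: nrmJ].
Qed.

Lemma gen_sq S K {nK : normal K} :
  (forall x h, gen S x -> K (gcomm x h)) -> (forall s, S s -> K (gmul s s)) ->
  forall x, gen S x -> K (gmul x x).
Proof.
move=> SK S2 x; elim=> {x} [x Sx||x y Sx Kx Sy Ky|x _ Kx].
- exact: S2.
- by rewrite gmul1g; exact: nrm1.
- by apply: sqM => //; apply: SK.
- by rewrite -ginvM; apply: nrmV.
Qed.

Lemma normal_closure_sq S K {nK : normal K} :
  (forall x h, normal_closure S x -> K (gcomm x h)) ->
  (forall s, S s -> K (gmul s s)) ->
  forall x, normal_closure S x -> K (gmul x x).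
Proof.
move=> SK S2; apply: gen_sq => // _ [s [g [Ss ->]]].
have -> : gmul (gconj s g) (gconj s g) = gconj (gmul s s) g by group_id.
by apply: nrmJ; apply: S2.
Qed.

Lemma comm_sql x h :
  gcomm (gmul x x) h = gmul (gmul (gcomm x h) (gcomm x h))
    (gconj (gcomm (gcomm x h) x) (gcomm x h)).
Proof. by group_id. Qed.

Lemma sq_comm x h :
  gmul (gcomm x h) (gcomm x h) =
  gmul (gcomm (gmul x x) h) (ginv (gconj (gcomm (gcomm x h) x) (gcomm x h))).
Proof. by rewrite comm_sql; move: (gcomm x h) => c; group_id. Qed.

Lemma comm_central_l K s x y {nK : normal K} : (forall h, K (gcomm s h)) ->
  K (gmul (ginv (gcomm x y)) (gcomm (gmul x s) y)).
Proof.
move=> Ks.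
have -> : gmul (ginv (gcomm x y)) (gcomm (gmul x s) y) =
  gmul (ginv (gcomm s (gcomm x y))) (gcomm s y) by group_id.
by apply: nrmM => //; apply: nrmV.
Qed.

Lemma gpowD x m n : gpow x (m + n) = gmul (gpow x m) (gpow x n).
Proof. by elim: m => [|m /= ->]; rewrite ?gmul1g ?gmulA. Qed.

Lemma gpow_exp2 x k : gpow x (2 ^ k.+1) = gmul (gpow x (2 ^ k)) (gpow x (2 ^ k)).
Proof. by rewrite expnS mul2n -addnn gpowD. Qed.

Lemma gpow_mul x m n : gpow x (m * n) = gpow (gpow x m) n.
Proof. by elim: n => [|n IH]; rewrite ?muln0 // mulnS gpowD IH. Qed.

Lemma gpow1 x : gpow x 1 = x. Proof. exact: gmulg1. Qed.

Lemma gpowS x n : gpow x n.+1 = gmul x (gpow x n). Proof. by []. Qed.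

Lemma gpowSr x n : gpow x n.+1 = gmul (gpow x n) x.
Proof. by rewrite -addn1 gpowD gpow1. Qed.

Lemma gpow_inv x n : gpow (ginv x) n = ginv (gpow x n).
Proof.
elim: n => [|n IH] /=; first by rewrite ginv1.
by rewrite IH -ginvM -[X in gmul _ X]gpow1 -gpowD addn1.
Qed.

Lemma gpow_conj x n g : gpow (gconj x g) n = gconj (gpow x n) g.
Proof. by elim: n => [|n /= ->]; group_id. Qed.

Lemma gpow_in K x n {nK : normal K} : K x -> K (gpow x n).
Proof. by move=> Kx; elim: n => [|n IH]; [exact: nrm1 | exact: nrmM]. Qed.

#[global] Instance lcs_normal n : normal (@lcs G n).
Proof.
case: n => [|n]; first by split.
elim: n => [|n IH]; first by split.
apply: gen_normal => _ g [x [y [Lx ->]]]; apply: gen_base.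
exists (gconj x g), (gconj y g); split; first exact: nrmJ.
by group_id.
Qed.

Lemma lcs_comm n x y : 0 < n -> @lcs G n x -> @lcs G n.+1 (gcomm x y).
Proof. by case: n => // n _ Lx; apply: gen_base; exists x, y. Qed.

(** This is E(i, d) with j = i + t; as t <= d, the truncated subtraction gives the true exponent i +
    d - j. *)
Definition pow_lcs i d : G -> Prop :=
  gen (fun z => exists t x, t <= d /\ @lcs G (i + t) x /\ z = gpow x (2 ^ (d - t))).

#[global] Instance pow_lcs_normal i d : normal (pow_lcs i d).
Proof.
apply: gen_normal => _ g [t [x [le_td [Lx ->]]]]; apply: gen_base.
exists t, (gconj x g); split=> //; split; last by rewrite gpow_conj.
exact: nrmJ.
Qed.

(** Replacing t by t + 1 keeps both the term of the series and the exponent d - t. *)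
Lemma pow_lcs_shift i d x : pow_lcs i.+1 d x -> pow_lcs i d.+1 x.
Proof.
apply: gen_sub => _ [t [y [le_td [Ly ->]]]]; apply: gen_base.
by exists t.+1, y; rewrite subSS addnS.
Qed.

Lemma pow_lcs_shiftn k i d x : pow_lcs (k + i) d x -> pow_lcs i (d + k) x.
Proof.
elim: k d => [|k IH] d; first by rewrite addn0.
by move/pow_lcs_shift/IH; rewrite addSnnS.
Qed.

(* Since [u^2, h] = e^2 [e, u]^e with e = [u, h], commuting with h moves
   [pow_lcs i d] up in [i]; this replaces Hall's collection formula. *)
Lemma pow_lcs_step d i : 0 < i ->
  (forall x h, pow_lcs i d x -> pow_lcs i.+1 d (gcomm x h)) /\
  (forall x, pow_lcs i d x -> pow_lcs i d.+1 (gmul x x)).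
Proof.
elim: d i => [|d IH] i i0.
  (* For d = 0 everything lies in Gamma_i, whose commutators are in Gamma_(i+1) and whose squares
     are generators of E(i, 1). *)
  have L0 x : pow_lcs i 0 x -> @lcs G i x.
    apply: gen_in.
    by move=> _ [t [y [+ [Ly ->]]]]; case: t Ly => // Ly _; rewrite gpow1 -[i]addn0.
  split=> [x h|x] /L0 Lx; apply: gen_base.
    exists 0, (gcomm x h); rewrite addn0 gpow1; split=> //; split=> //.
    exact: lcs_comm.
  by exists 0, x; rewrite addn0 /= gmulg1.
have [IHc IHs] := IH i i0; have [JHc JHs] := IH i.+1 isT.
have [JJc _] := IH i.+2 isT.
have C x h : pow_lcs i d.+1 x -> pow_lcs i.+1 d.+1 (gcomm x h).
  apply: gen_comm => _ {}h [[|t] [y [le_td [Ly ->]]]].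
    (* For t = 0 the generator is u^2 with u = y^(2^d) in E(i, d). Then e^2 lies in E(i+1, d+1), and
       [e, u] in E(i+2, d), which is contained in E(i+1, d+1). *)
    rewrite subn0 gpow_exp2 comm_sql.
    have Eu : pow_lcs i d (gpow y (2 ^ d)).
      by apply: gen_base; exists 0, y; rewrite subn0.
    apply: nrmM; first exact/JHs/IHc.
    by apply: nrmJ; apply: pow_lcs_shift; apply: JHc; apply: IHc.
  (* For t > 0 the generator already lies in E(i+1, d), so its commutators are in E(i+2, d). *)
  apply: pow_lcs_shift; apply: JHc; apply: gen_base.
  by exists t, y; rewrite addSn -addnS subSS.
split=> //; apply: gen_sq.
  by move=> x h Ex; apply: pow_lcs_shift; apply: C.
move=> _ [t [y [le_td [Ly ->]]]]; rewrite -gpow_exp2 -subSn //.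
by apply: gen_base; exists t, y; split=> //; apply: leqW.
Qed.

Lemma lcs_comm2 m x t : 0 < m -> @lcs G m x -> @lcs G 2 t ->
  @lcs G m.+2 (gcomm x t).
Proof.
move=> m0 Lx Lt; apply: gcommC_in; move: t x Lt Lx.
(* x centralises each [p, q] modulo Gamma_(m+2) because p^x = p[p, x] with [p, x] central *)
suff H p q x : @lcs G m x -> @lcs G m.+2 (gcomm (gcomm p q) x).
  move=> t x Lt; elim: Lt x => {t} [_ [p [q [_ ->]]] x||s t _ Hs _ Ht x Lx|s _ Hs x Lx].
  - exact: H.
  - move=> x _; have -> : gcomm gone x = gone by group_id.
  exact: nrm1.
  - have -> : gcomm (gmul s t) x = gmul (gconj (gcomm s x) t) (gcomm t x) by group_id.
    by apply: nrmM; [apply: nrmJ; apply: Hs | apply: Ht].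
  - have -> : gcomm (ginv s) x = ginv (gconj (gcomm s x) (ginv s)) by group_id.
    by apply: nrmV; apply: nrmJ; apply: Hs.
move=> Lx.
have cen r h : @lcs G m.+2 (gcomm (gcomm r x) h).
  apply: lcs_comm => //.
  by apply: gcommC_in; apply: lcs_comm.
set p' := gmul p (gcomm p x); set q' := gmul q (gcomm q x).
(* [[p, q], x] = [p, q]^-1 [p', q'] is split at [p', q], so that each factor changes a single entry
   by a central element. *)
have -> : gcomm (gcomm p q) x = gmul
   (gmul (ginv (gcomm p q)) (gcomm p' q))
   (gconj (ginv (gmul (ginv (gcomm q p')) (gcomm q' p'))) (gcomm p' q)).
  by rewrite /p' /q'; group_id.
apply: nrmM; first exact: comm_central_l.
by apply: nrmJ; apply: nrmV; apply: comm_central_l.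
Qed.

End Generic.

(** * Squares along the lower central series *)

Section Squares.
Context {G : Grp} {LG : group_laws G}.
Implicit Types (x y : G) (S : G -> Prop).

(** Induction on j: modulo Gamma_(j+1) squaring is multiplicative on Gamma_j, so generators suffice.
    For a generator [x, y], [sq_comm] reduces the square to [x^2, y], where x^2 is one term deeper
    by induction, and to a triple commutator. *)
Lemma lcs_sq : (forall x y : G, @lcs G 3 (gmul (gcomm x y) (gcomm x y))) ->
  forall j x, 2 <= j -> @lcs G j x -> @lcs G j.+1 (gmul x x).
Proof.
move=> H2; case=> [|[|j]] // x _; elim: j x => [|j IH] x.
  apply: gen_sq.
    by move=> {}x h Lx; apply: (@lcs_comm _ 2).
  by move=> _ [u [v [_ ->]]].
apply: gen_sq => [{}x h Lx|]; first exact: (@lcs_comm _ j.+3).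
move=> _ [{}x [y [Lx ->]]]; rewrite sq_comm.
have Lc : @lcs G j.+3 (gcomm x y) by apply: (@lcs_comm _ j.+2).
apply: nrmM; first by apply: (@lcs_comm _ j.+3) => //; apply: IH.
by apply: nrmV; apply: nrmJ; apply: (@lcs_comm _ j.+3).
Qed.

(** In [sq_comm] both factors lie in Gamma_3: [x^2, y] because x^2 is in Gamma_2, and [[x, y], x] by
    definition. *)
Lemma comm_sq_of_sq x y : @lcs G 2 (gmul x x) ->
  @lcs G 3 (gmul (gcomm x y) (gcomm x y)).
Proof.
move=> Lx.
rewrite sq_comm; apply: nrmM; first exact: lcs_comm.
by apply: nrmV; apply: nrmJ; apply: lcs_comm => //; apply: lcs_comm.
Qed.

Lemma comm_sqC x y : @lcs G 3 (gmul (gcomm x y) (gcomm x y)) ->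
  @lcs G 3 (gmul (gcomm y x) (gcomm y x)).
Proof.
have -> : gcomm y x = ginv (gcomm x y) by group_id.
by rewrite -ginvM; apply: nrmV.
Qed.

(** Modulo Gamma_3 the commutator is bilinear and its values commute. Hence the property extends
    from generators in the first entry, and after a swap of the entries in the second. *)
Lemma comm_sq_gen S : (forall x, gen S x) ->
  (forall s t, S s -> S t -> @lcs G 3 (gmul (gcomm s t) (gcomm s t))) ->
  forall x y, @lcs G 3 (gmul (gcomm x y) (gcomm x y)).
Proof.
move=> genS SS.
have step y : (forall s, S s -> @lcs G 3 (gmul (gcomm s y) (gcomm s y))) ->
    forall x, @lcs G 3 (gmul (gcomm x y) (gcomm x y)).
  move=> Sy x; elim: (genS x) => {x} [x /Sy //||x z _ Hx _ Hz|x _ Hx].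
  - have -> : gcomm gone y = gone by group_id.
    by rewrite gmul1g; apply: nrm1.
  - have -> : gcomm (gmul x z) y = gmul (gconj (gcomm x y) z) (gcomm z y) by group_id.
    apply: sqM => //; first by apply: lcs_comm => //; apply: lcs_comm.
    have -> : gmul (gconj (gcomm x y) z) (gconj (gcomm x y) z) =
      gconj (gmul (gcomm x y) (gcomm x y)) z by group_id.
    exact: nrmJ.
  - have -> : gcomm (ginv x) y = ginv (gconj (gcomm x y) (ginv x)) by group_id.
    have -> : gmul (ginv (gconj (gcomm x y) (ginv x))) (ginv (gconj (gcomm x y) (ginv x)))
      = ginv (gconj (gmul (gcomm x y) (gcomm x y)) (ginv x)) by group_id.
    by apply: nrmV; apply: nrmJ.
move=> x y; apply: (step y) => s Ss; apply: comm_sqC; apply: (step s) => t St.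
exact: SS.
Qed.

Lemma lcs_pow2 j k x : (forall x y : G, @lcs G 3 (gmul (gcomm x y) (gcomm x y))) ->
  2 <= j -> @lcs G j x -> @lcs G (j + k) (gpow x (2 ^ k)).
Proof.
move=> H2 j2 Lx; elim: k => [|k IH]; first by rewrite addn0 gpow1.
by rewrite gpow_exp2 addnS; apply: lcs_sq => //; apply: ltn_addr.
Qed.

End Squares.

(** * Homomorphisms *)

Definition is_hom (G G' : Grp) (f : G -> G') : Prop :=
  forall x y, f (gmul x y) = gmul (f x) (f y).

Section Hom.
Context {G G' : Grp} {LG : group_laws G} {LG' : group_laws G'} (f : G -> G').
Hypothesis fM : is_hom f.

Lemma hom1 : f gone = gone.
Proof. by apply: (@gmul_inj _ _ (f gone)); rewrite -fM gmul1g gmulg1. Qed.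

Lemma homV x : f (ginv x) = ginv (f x).
Proof. by apply: (@gmul_inj _ _ (f x)); rewrite -fM !gmulgV hom1. Qed.

Lemma hom_gcomm x y : f (gcomm x y) = gcomm (f x) (f y).
Proof. by rewrite /gcomm !fM !homV. Qed.

Lemma hom_gconj x y : f (gconj x y) = gconj (f x) (f y).
Proof. by rewrite /gconj !fM !homV. Qed.

Lemma hom_gpow x n : f (gpow x n) = gpow (f x) n.
Proof. by elim: n => [|n /= <-]; [exact: hom1 | exact: fM]. Qed.

Lemma hom_lcs n x : @lcs G n x -> @lcs G' n (f x).
Proof.
case: n => [|n] //; elim: n x => [|n IH] // x; elim=> {x}.
- move=> _ [x [y [Lx ->]]]; rewrite hom_gcomm; apply: lcs_comm => //; exact: IH.
- rewrite hom1; exact: gen_one.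
- by move=> x y _ Hx _ Hy; rewrite fM; apply: gen_mul.
- by move=> x _ Hx; rewrite homV; apply: gen_inv.
Qed.

End Hom.

(** The displacement x^-1 f(x) is a cocycle: at xy it is the conjugate by y of its value at x, times
    its value at y. *)
Lemma hom_gen_cong (G : Grp) (LG : group_laws G) (f : G -> G) (S K : G -> Prop) {nK : normal K} :
  is_hom f -> (forall s, S s -> K (gmul (ginv s) (f s))) ->
  forall x, gen S x -> K (gmul (ginv x) (f x)).
Proof.
move=> fM SK x; elim=> {x} [x /SK //||x y _ Kx _ Ky|x _ Kx].
- rewrite (hom1 fM) gmulVg; exact: nrm1.
- have -> : gmul (ginv (gmul x y)) (f (gmul x y)) =
    gmul (gconj (gmul (ginv x) (f x)) y) (gmul (ginv y) (f y)).
    by rewrite fM; group_id.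
  by apply: nrmM => //; exact: nrmJ.
- have -> : gmul (ginv (ginv x)) (f (ginv x)) =
    gconj (ginv (gmul (ginv x) (f x))) (ginv x) by rewrite homV //; group_id.
  by apply: nrmJ; exact: nrmV.
Qed.

(** * The free group on two letters *)

Lemma inv_lK : involutive inv_l.
Proof. by case=> g e; rewrite /inv_l /= negbK. Qed.

Lemma cons_redK x w : reduced w -> cons_red x (cons_red (inv_l x) w) = w.
Proof.
case: w => [|y w] rw /=; first by rewrite eqxx.
rewrite inv_lK; case: eqP rw => [->|ne] rw /=; last by rewrite eqxx.
case: w rw => [|z w] //= /andP[ne _].
by rewrite (negPf ne).
Qed.

Lemma foldr_cons_red x s w : reduced w -> reduced s ->
  foldr cons_red w (cons_red x s) = cons_red x (foldr cons_red w s).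
Proof.
move=> rw; case: s => [|y s] //= rs; case: eqP => [->|//].
by rewrite cons_redK // foldr_red_reduced.
Qed.

(** This is associativity of the product: words act on reduced words letter by letter, and the
    action respects cancellation. *)
Lemma foldr_red_cat s t w : reduced t -> reduced w ->
  foldr cons_red w (foldr cons_red t s) = foldr cons_red (foldr cons_red w t) s.
Proof.
move=> rt rw; elim: s => [|x s IH] //=.
by rewrite foldr_cons_red ?foldr_red_reduced // IH.
Qed.

Lemma foldr_red_nil s : reduced s -> foldr cons_red [::] s = s.
Proof.
elim: s => [|x s IH] //= rs; rewrite IH; last exact: path_sorted rs.
by case: s rs {IH} => [|y s] //= /andP[/negPf ->].
Qed.

Lemma foldr_red_inv s w : reduced w ->
  foldr cons_red (foldr cons_red w s) (rev (map inv_l s)) = w.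
Proof.
elim: s w => [|x s IH] w rw //=.
rewrite rev_cons foldr_rcons -{2}[x]inv_lK cons_redK ?foldr_red_reduced //.
exact: IH.
Qed.

#[global] Instance FG_laws : group_laws FreeGrp.
Proof.
split.
- move=> [s rs] [t rt] [w rw]; apply: val_inj => /=; by rewrite foldr_red_cat.
- by move=> [s rs]; apply: val_inj.
- move=> [s rs]; apply: val_inj => /=.
  by rewrite foldr_red_cat //= -{1}(foldr_red_nil rs) foldr_red_inv //=.
Qed.

Definition FGgens : FreeGrp -> Prop := fun x => x = a2 \/ x = b2.

Lemma FG_gen (u : FreeGrp) : gen FGgens u.
Proof.
have genl (x : letter) : gen FGgens (exist _ [:: x] isT : FreeGrp).
  case: x => [[] []]; try by (apply: gen_base;
    first [by left; apply: val_inj | by right; apply: val_inj]).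
    suff -> : exist _ [:: (true, true)] isT = ginv b2 :> FreeGrp.
      by apply: gen_inv; apply: gen_base; right.
    exact: val_inj.
  suff -> : exist _ [:: (false, true)] isT = ginv a2 :> FreeGrp.
    by apply: gen_inv; apply: gen_base; left.
  exact: val_inj.
case: u => s; elim: s => [|x s IH] rs.
  suff -> : exist _ [::] rs = gone :> FreeGrp by exact: gen_one.
  exact: val_inj.
have rs' : reduced s by exact: path_sorted rs.
suff -> : exist _ (x :: s) rs = fg_mul (exist _ [:: x] isT) (exist _ s rs') :> FG.
  exact: (@gen_mul FreeGrp).
apply: val_inj => /=; case: s rs {IH rs'} => [|y s] //= /andP[/negPf -> _].
by [].
Qed.

Lemma FG_hom_ext (G : Grp) (LG : group_laws G) (f g : FreeGrp -> G) :
  is_hom f -> is_hom g -> f a2 = g a2 -> f b2 = g b2 -> f =1 g.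
Proof.
move=> fM gM fga fgb u; elim: (FG_gen u) => {u} [x [] -> //||x y _ ex _ ey|x _ ex].
- by rewrite (hom1 fM) (hom1 gM).
- by rewrite fM gM ex ey.
- by rewrite (homV fM) (homV gM) ex.
Qed.

Lemma fsubst_hom ia ib : is_hom (fsubst ia ib : FreeGrp -> FreeGrp).
Proof.
pose y (x : letter) : FreeGrp := let z := if x.1 then ib else ia in
  if x.2 then fg_inv z else z.
pose F (s : seq letter) : FreeGrp := foldr (fun x => gmul (y x)) gone s.
have yV x : y (inv_l x) = ginv (y x).
  by case: x => g [] //; apply/esym/(@ginvK FreeGrp).
(* Cancelling two inverse letters does not change the value of [F], so substitution ignores
   reduction. *)
have FC x s : F (cons_red x s) = gmul (y x) (F s).
  case: s => [|z s] //; rewrite [cons_red _ _]/=; case: eqP => [->|//].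
  by rewrite [F (_ :: s)]/(gmul (y _) (F s)) yV gmulKVg.
move=> u v; rewrite [LHS]/(F (foldr _ _ _)) [RHS]/(gmul (F (sval u)) (F (sval v))).
elim: (sval u) => [|x s IH]; first exact/esym/gmul1g.
apply: etrans (FC x _) _.
by apply: etrans (congr1 (gmul (y x)) IH) _; apply: (@gmulA FreeGrp).
Qed.

Lemma fsubst_a ia ib : fsubst ia ib a2 = ia.
Proof. exact: (@gmulg1 FreeGrp). Qed.

Lemma fsubst_b ia ib : fsubst ia ib b2 = ib.
Proof. exact: (@gmulg1 FreeGrp). Qed.

(** * The subgroups [Nn n] *)

#[global] Instance Nn_normal n : normal (Nn n).
Proof. exact: normal_closure_normal. Qed.

Lemma Nn_a n : Nn n (gpow a2 (2 ^ (n - 1))).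
Proof. by apply: normal_closure_base; left. Qed.

Lemma Nn_lcs n i (x : FreeGrp) : 2 <= i <= n -> @lcs FreeGrp i x ->
  Nn n (gpow x (2 ^ (n - i))).
Proof. by move=> i2n Lx; apply: normal_closure_base; right; exists i, x. Qed.

(** The generators of E(2, n-2) are those of N_n other than the power of a2; here n = d + 2. *)
Lemma Nn_pow_lcs d x : pow_lcs (G := FreeGrp) 2 d x -> Nn d.+2 x.
Proof.
apply: gen_in.
move=> _ [t [y [le_td [Ly ->]]]].
have := @Nn_lcs d.+2 (2 + t) y _ Ly; rewrite !addSn add0n !subSS; apply.
by rewrite !ltnS.
Qed.

Lemma Nn_of_lcs n x : 2 <= n -> @lcs FreeGrp n x -> Nn n x.
Proof.
move=> n2 Lx; have := @Nn_lcs n n x; rewrite n2 leqnn subnn gpow1; exact.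
Qed.

(** Up to conjugation each generator of N_n is x^(2^t) with x in Gamma_i and i + t = n, where a2
    counts with i = 1. Its commutators lie in E(i+1, t), which shifts into E(2, n-1) and so into
    N_(n+1). *)
Lemma Nn_comm n x h : 2 <= n -> Nn n x -> Nn n.+1 (gcomm x h).
Proof.
case: n => [|[|d]] // _; move: x h.
have step i t x h : 0 < i -> i + t = d.+2 -> @lcs FreeGrp i x -> t <= d.+1 ->
    Nn d.+3 (gcomm (gpow x (2 ^ t)) h).
  move=> i0 it Lx td; apply: (@Nn_pow_lcs d.+1).
  have [C _] := pow_lcs_step (G := FreeGrp) t i0.
  have /C-/(_ h) : pow_lcs i t (gpow x (2 ^ t)).
    by apply: gen_base; exists 0, x; rewrite addn0 subn0.
  have -> : d.+1 = t + i.-1 by lia.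
  by move=> Ez; apply: pow_lcs_shiftn; rewrite addn2 prednK.
apply: normal_closure_comm => s h [->|[i [x [i2 [Lx ->]]]]].
- by rewrite subSS subn0; apply: (step 1).
- by apply: (step i) => //; lia.
Qed.

Lemma Nn_sq n x : 2 <= n -> Nn n x -> Nn n.+1 (gmul x x).
Proof.
move=> n2; apply: normal_closure_sq.
  by move=> y h; apply: Nn_comm.
move=> _ [->|[i [y [i2 [Ly ->]]]]]; rewrite -gpow_exp2.
  by rewrite -subSn ?(ltnW n2) //; apply: Nn_a.
by rewrite -subSn; [apply: Nn_lcs => //; lia | lia].
Qed.

(** Isolates what all [phi g] share and composition preserves. The exact condition on a2, rather
    than a congruence, keeps f(a2^(2^(n-1))) in N_n. *)
Definition admissible (f : FreeGrp -> FreeGrp) : Prop :=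
  [/\ is_hom f, f a2 = a2 \/ f a2 = ginv a2 & Nn 2 (gmul (ginv b2) (f b2))].

Lemma Nn_hom f n x : admissible f -> Nn n x -> Nn n (f x).
Proof.
move=> [fM fa _]; elim=> {x}.
- move=> _ [s [g [Ss ->]]]; rewrite (hom_gconj fM); apply: nrmJ.
  case: Ss => [->|[i [x [i2 [Lx ->]]]]]; rewrite (hom_gpow fM).
    case: fa => ->; first exact: Nn_a.
    by rewrite gpow_inv; apply: nrmV; apply: Nn_a.
  by apply: Nn_lcs => //; apply: hom_lcs.
- rewrite (hom1 fM); exact: nrm1.
- by move=> x y _ Hx _ Hy; rewrite fM; apply: nrmM.
- by move=> x _ Hx; rewrite (homV fM); apply: nrmV.
Qed.

Lemma admissible_N2 f x : admissible f -> Nn 2 (gmul (ginv x) (f x)).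
Proof.
move=> [fM fa fb].
apply: (hom_gen_cong _ fM) (FG_gen x) => s [->|-> //].
case: fa => ->; first by rewrite gmulVg; apply: nrm1.
have -> : gmul (ginv a2) (ginv a2) = ginv (gpow a2 (2 ^ (2 - 1))).
  by rewrite gpow_exp2 gpow1 ginvM.
by apply: nrmV; apply: Nn_a.
Qed.

Lemma admissible_comp f g : admissible f -> admissible g -> admissible (f \o g).
Proof.
move=> af [gM ga gb]; have [fM fa fb] := af.
split.
- by move=> x y /=; rewrite gM fM.
- by rewrite /=; case: ga => ->; rewrite ?(homV fM); case: fa => ->;
    rewrite ?ginvK; auto.
- have -> : gmul (ginv b2) ((f \o g) b2) =
    gmul (gmul (ginv b2) (f b2)) (f (gmul (ginv b2) (g b2))).
    by rewrite -[(f \o g) b2]/(f (g b2)) fM (homV fM); group_id.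
  by apply: nrmM => //; apply: Nn_hom.
Qed.

(** For the generator a2^2, put e = [a2, y] in Gamma_(m+1): then [a2^2, y] = e^2 [e, a2]^e, where
    e^2 is a generator of N_(m+2) and [e, a2] is in Gamma_(m+2). The generators from Gamma_2 are
    covered by [lcs_comm2]. *)
Lemma lcs_comm_N2 m x t : 0 < m -> @lcs FreeGrp m x -> Nn 2 t ->
  Nn m.+2 (gcomm x t).
Proof.
move=> m0 Lx Nt.
apply: gcommC_in; move: Lx.
suff H s y : (s = gpow a2 (2 ^ (2 - 1)) \/
   exists i z, 2 <= i <= 2 /\ @lcs FreeGrp i z /\ s = gpow z (2 ^ (2 - i))) ->
   @lcs FreeGrp m y -> Nn m.+2 (gcomm s y).
  elim: Nt x => {t} [_ [s [g [Ss ->]]] x Lx||s t _ Hs _ Ht x Lx|s _ Hs x Lx].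
  - have -> : gcomm (gconj s g) x = gconj (gcomm s (gconj x (ginv g))) g by group_id.
    by apply: nrmJ; apply: H => //; apply: nrmJ.
  - move=> x _; have -> : gcomm gone x = gone by group_id.
    exact: nrm1.
  - have -> : gcomm (gmul s t) x = gmul (gconj (gcomm s x) t) (gcomm t x) by group_id.
    by apply: nrmM; [apply: nrmJ; apply: Hs | apply: Ht].
  - have -> : gcomm (ginv s) x = ginv (gconj (gcomm s x) (ginv s)) by group_id.
    by apply: nrmV; apply: nrmJ; apply: Hs.
case=> [->|[i [z [i2 [Lz ->]]]]] Ly.
  rewrite gpow_exp2 gpow1 comm_sql.
  have Lc : @lcs FreeGrp m.+1 (gcomm a2 y).
    by apply: gcommC_in; apply: lcs_comm.
  apply: nrmM.
    have := @Nn_lcs m.+2 m.+1 _ _ Lc; rewrite subSn // subnn gpow_exp2 gpow1.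
    by apply; rewrite ltnS m0 leqnSn.
  by apply: nrmJ; apply: Nn_of_lcs => //; apply: lcs_comm.
have ei : i = 2 by lia.
rewrite ei subnn gpow1; apply: Nn_of_lcs => //.
by apply: gcommC_in; apply: lcs_comm2; rewrite -?ei.
Qed.

(** Induction on m through [x, y], with f(x) = xs and f(y) = yt. By induction s is central modulo
    the target and drops out; what t contributes is [x, t] and [[x, y], t], up to conjugation. *)
Lemma admissible_lcs f m x : admissible f -> 0 < m -> @lcs FreeGrp m x ->
  Nn m.+1 (gmul (ginv x) (f x)).
Proof.
move=> af; have [fM _ _] := af; case: m => // m _.
elim: m x => [|m IH] x; first by move=> _; apply: admissible_N2.
apply: hom_gen_cong => // _ [{}x [y [Lx ->]]]; rewrite (hom_gcomm fM).
set s := gmul (ginv x) (f x); set t := gmul (ginv y) (f y).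
have -> : f x = gmul x s by rewrite /s gmulKVg.
have -> : f y = gmul y t by rewrite /t gmulKVg.
have Ns : Nn m.+2 s by apply: IH.
have Nt : Nn 2 t by apply: admissible_N2.
have Lxy : @lcs FreeGrp m.+2 (gcomm x y) by apply: lcs_comm.
have -> : gmul (ginv (gcomm x y)) (gcomm (gmul x s) (gmul y t)) =
  gmul (gmul (gconj (gcomm x t) (gcomm x y)) (gcomm (gcomm x y) t))
       (gmul (ginv (gcomm x (gmul y t))) (gcomm (gmul x s) (gmul y t))).
  by group_id.
apply: nrmM; last by apply: comm_central_l => h; apply: Nn_comm.
apply: nrmM; first by apply: nrmJ; apply: lcs_comm_N2.
by apply: Nn_of_lcs => //; apply: lcs_comm.
Qed.

(** Since N_n is central modulo N_(n+1), conjugation of a generator is harmless. If [f] inverts a2,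
    the displacement of a2^(2^(n-1)) is a2^(-2^n). *)
Lemma admissible_Nn f n x : admissible f -> 2 <= n -> Nn n x ->
  Nn n.+1 (gmul (ginv x) (f x)).
Proof.
move=> af n2; have [fM fa _] := af.
apply: hom_gen_cong => // _ [s [g [Ss ->]]]; rewrite (hom_gconj fM).
have Ns : Nn n s by apply: normal_closure_base.
have -> : gmul (ginv (gconj s g)) (gconj (f s) (f g)) =
  gmul (ginv (gcomm s g)) (gmul (gmul (ginv s) (f s)) (gcomm (f s) (f g)))
  by group_id.
apply: nrmM; first by apply: nrmV; apply: Nn_comm.
apply: nrmM; last by apply: Nn_comm => //; apply: Nn_hom.
case: Ss => [->|[i [y [i2 [Ly ->]]]]].
  rewrite (hom_gpow fM); case: fa => ->; first by rewrite gmulVg; apply: nrm1.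
  by rewrite gpow_inv -ginvM -gpow_exp2 -subSn ?(ltnW n2) //; apply/nrmV/Nn_a.
have -> : n.+1 = (i + (n - i)).+1 by lia.
have i0 : 0 < i by lia.
(* Induction on the number k of squarings. With u = y^(2^k), the displacement r of u lies in
   N_(i+k+1); that of u^2 is r^2 [r, u]^r, one level deeper. *)
elim: (n - i) => [|k IH]; first by rewrite gpow1 addn0; apply: admissible_lcs.
move: IH; rewrite gpow_exp2 addnS; set u := gpow y _ => IH.
set r := gmul (ginv u) (f u) in IH; have -> : f (gmul u u) = gmul (gmul u r) (gmul u r).
  by rewrite fM /r gmulKVg.
have -> : gmul (ginv (gmul u u)) (gmul (gmul u r) (gmul u r)) =
  gmul (gmul r r) (gconj (gcomm r u) r) by group_id.
apply: nrmM; first by apply: Nn_sq => //; lia.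
by apply: nrmJ; apply: Nn_comm => //; lia.
Qed.

(** * The action of the Klein bottle group *)

Lemma phiA_hom : is_hom (phiA : FreeGrp -> FreeGrp).
Proof. exact: fsubst_hom. Qed.
Lemma phiAinv_hom : is_hom (phiAinv : FreeGrp -> FreeGrp).
Proof. exact: fsubst_hom. Qed.
Lemma phiB_hom : is_hom (phiB : FreeGrp -> FreeGrp).
Proof. exact: fsubst_hom. Qed.

Lemma phiA_a : phiA a2 = a2. Proof. exact: fsubst_a. Qed.
Lemma phiAinv_a : phiAinv a2 = a2. Proof. exact: fsubst_a. Qed.
Lemma phiB_a : phiB a2 = ginv (a2 : FreeGrp). Proof. exact: fsubst_a. Qed.
Lemma phiA_b : phiA b2 = gmul (ginv (gmul (a2 : FreeGrp) a2)) b2.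
Proof. exact: fsubst_b. Qed.
Lemma phiAinv_b : phiAinv b2 = gmul (gmul (a2 : FreeGrp) a2) b2.
Proof. exact: fsubst_b. Qed.
Lemma phiB_b : phiB b2 = gmul (a2 : FreeGrp) (gmul b2 a2).
Proof. exact: fsubst_b. Qed.

Lemma Nn2_aa : Nn 2 (gmul a2 a2).
Proof. by have := Nn_a 2; rewrite gpow_exp2 gpow1. Qed.

Lemma phiA_admissible : admissible phiA.
Proof.
split; [exact: phiA_hom | by left; exact: phiA_a |].
by rewrite phiA_b gmulA; apply: (@nrmJ _ (Nn 2)); apply: nrmV; exact: Nn2_aa.
Qed.

Lemma phiAinv_admissible : admissible phiAinv.
Proof.
split; [exact: phiAinv_hom | by left; exact: phiAinv_a |].
by rewrite phiAinv_b gmulA; apply: (@nrmJ _ (Nn 2)); exact: Nn2_aa.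
Qed.

Lemma phiB_admissible : admissible phiB.
Proof.
split; [exact: phiB_hom | by right; exact: phiB_a |].
have -> : gmul (ginv (b2 : FreeGrp)) (phiB b2) =
  gmul (gconj (gmul a2 a2) b2) (gcomm b2 a2) by rewrite phiB_b; group_id.
apply: nrmM; first by apply: nrmJ; exact: Nn2_aa.
by apply: Nn_of_lcs => //; apply: lcs_comm.
Qed.

Definition powA (m : int) : FG -> FG :=
  iter `|m|%N (if (0 <= m)%R then phiA else phiAinv).

Lemma comp_hom (f g : FreeGrp -> FreeGrp) : is_hom f -> is_hom g -> is_hom (f \o g).
Proof. by move=> fM gM x y; rewrite /= gM fM. Qed.

Lemma phiAK : cancel phiA phiAinv.
Proof.
apply: (@FG_hom_ext FreeGrp FG_laws (phiAinv \o phiA) id) => //=.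
- apply: comp_hom; [exact: phiAinv_hom | exact: phiA_hom].
- by rewrite phiA_a phiAinv_a.
- rewrite phiA_b phiAinv_hom (homV phiAinv_hom) phiAinv_hom phiAinv_a phiAinv_b.
  by group_id.
Qed.

Lemma phiAVK : cancel phiAinv phiA.
Proof.
apply: (@FG_hom_ext FreeGrp FG_laws (phiA \o phiAinv) id) => //=.
- apply: comp_hom; [exact: phiA_hom | exact: phiAinv_hom].
- by rewrite phiAinv_a phiA_a.
- rewrite phiAinv_b phiA_hom phiA_hom phiA_a phiA_b.
  by group_id.
Qed.

(** This is why [phi] may depend only on the parity of the exponent of beta. *)
Lemma phiBK : involutive phiB.
Proof.
apply: (@FG_hom_ext FreeGrp FG_laws (phiB \o phiB) id) => //=.
- apply: comp_hom; exact: phiB_hom.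
- by rewrite phiB_a (homV phiB_hom) phiB_a ginvK.
- rewrite phiB_b phiB_hom phiB_hom phiB_a phiB_b.
  by group_id.
Qed.

(** The defining relation of G, read on automorphisms; it is checked on a2 and b2. *)
Lemma phiBA x : phiB (phiA x) = phiAinv (phiB x).
Proof.
apply: (@FG_hom_ext FreeGrp FG_laws (phiB \o phiA) (phiAinv \o phiB)) => /=.
- apply: comp_hom; [exact: phiB_hom | exact: phiA_hom].
- apply: comp_hom; [exact: phiAinv_hom | exact: phiB_hom].
- by rewrite phiA_a phiB_a (homV phiAinv_hom) phiAinv_a.
- rewrite phiA_b phiB_b phiB_hom (homV phiB_hom) phiB_hom phiB_a phiB_b.
  rewrite phiAinv_hom phiAinv_hom phiAinv_a phiAinv_b.
  by group_id.
Qed.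

Lemma phiBAinv x : phiB (phiAinv x) = phiA (phiB x).
Proof. by rewrite -[x in RHS]phiAVK phiBA phiAVK. Qed.

Import GRing.Theory.
Local Open Scope ring_scope.

Lemma powA1D m x : powA (1 + m) x = phiA (powA m x).
Proof.
rewrite /powA; case: m => m.
  by rewrite -intS.
case: m => [|m]; first by rewrite /= phiAVK.
have -> : 1 + Negz m.+1 = Negz m by rewrite !NegzE; lia.
by rewrite /= phiAVK.
Qed.

Lemma powA_predD m x : powA (-1 + m) x = phiAinv (powA m x).
Proof. by rewrite -[RHS]/(phiAinv (powA m x)) -{2}[m](addKr (-1)) opprK powA1D phiAK. Qed.

Lemma powAD m n x : powA (m + n) x = powA m (powA n x).
Proof.
elim: m => [|m IH|m IH]; first by rewrite add0r.
- by rewrite intS -addrA !powA1D IH.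
- have -> : - m.+1%:Z = -1 + - m%:Z by lia.
  by rewrite -addrA !powA_predD IH.
Qed.

Lemma phiB_powA m x : phiB (powA m x) = powA (- m) (phiB x).
Proof.
elim: m => [|m IH|m IH]; first by [].
- have -> : - m.+1%:Z = -1 + - m%:Z by lia.
  by rewrite powA_predD -IH intS powA1D phiBA.
- have -> : - m.+1%:Z = -1 + - m%:Z by lia.
  rewrite powA_predD phiBAinv IH opprD !opprK powA1D. by [].
Qed.

Lemma powA_admissible m : admissible (powA m).
Proof.
have adm_id : admissible id.
  split; [by [] | by left | rewrite gmulVg; apply: gen_one].
rewrite /powA; elim: `|m|%N => [|k IH] //.
apply: (@admissible_comp _ (iter k _) _ IH).
by case: ifP => _; [exact: phiA_admissible | exact: phiAinv_admissible].
Qed.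

Lemma phiE g x : phi g x = powA g.1 (if odd `|g.2|%N then phiB x else x).
Proof. by []. Qed.

Lemma phi_admissible g : admissible (phi g).
Proof.
have [fM fa fb] := powA_admissible g.1; case E: (odd `|g.2|%N).
  have -> : (phi g : FreeGrp -> FreeGrp) = powA g.1 \o phiB.
    by rewrite /phi E.
  exact: admissible_comp (powA_admissible _) phiB_admissible.
have -> : (phi g : FreeGrp -> FreeGrp) = powA g.1 by rewrite /phi E.
by [].
Qed.

Lemma phi_hom g : is_hom (phi g : FreeGrp -> FreeGrp).
Proof. by have [] := phi_admissible g. Qed.

(** Moving [phiB] past [powA] negates the exponent, which is the sign in [kmul]; two copies of
    [phiB] cancel. *)
Lemma phiM g h x : phi (kmul g h) x = phi g (phi h x).
Proof.
rewrite !phiE /= /ksign powAD.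
have -> : odd (absz (g.2 + h.2)%R) = odd `|g.2|%N (+) odd `|h.2|%N by lia.
case: (odd `|g.2|%N) => //=; rewrite phiB_powA.
by case: (odd `|h.2|%N) => //=; rewrite phiBK.
Qed.

Lemma phi1 x : phi kone x = x. Proof. by []. Qed.

#[global] Instance KleinGrp_laws : group_laws KleinGrp.
Proof.
split.
- move=> [m n] [m' n'] [m'' n'']; rewrite /= /kmul /ksign /=.
  have -> : odd (absz (n + n')%R) = odd `|n|%N (+) odd `|n'|%N by lia.
  congr pair; last by rewrite addrA.
  by case: (odd `|n|%N); case: (odd `|n'|%N) => /=; lia.
- by move=> [m n]; rewrite /= /kmul /ksign /= !add0r.
- move=> [m n]; rewrite /= /kmul /kinv /kone /ksign /= abszN.
  by case: (odd `|n|%N); congr pair; lia.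
Qed.

#[global] Instance P2K_laws : group_laws P2K.
Proof.
split.
- move=> [u g] [v h] [w k]; rewrite /= /pmul /=; congr pair.
    rewrite phiM; apply: etrans (congr1 (fg_mul u) (phi_hom g _ _)) _.
    exact: (@gmulA FreeGrp).
  exact: (@gmulA KleinGrp).
- move=> [u g]; rewrite /= /pmul /= phi1; congr pair.
    exact: (@gmul1g FreeGrp).
  exact: (@gmul1g KleinGrp).
- move=> [u g]; rewrite /= /pmul /pinv /=; congr pair.
    apply: etrans (esym (phi_hom (kinv g) _ _)) _.
    by apply: etrans (congr1 _ (@gmulVg FreeGrp _ u)) _; exact: (hom1 (phi_hom _)).
  exact: (@gmulVg KleinGrp).
Qed.

(** * The semidirect products on the right-hand side, and the inclusion of Gamma_n in them *)

Definition KGpow n (g : KG) : Prop := exists c : int, g = (c * 2 ^+ (n - 1), 0).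

Lemma gpow_alpha m : gpow alpha m = (m%:Z, 0) :> KG.
Proof.
elim: m => [|m IH] //; rewrite [gpow _ _]/(kmul alpha (gpow alpha m)) IH.
by rewrite /kmul /ksign /= addr0 intS.
Qed.

Lemma gen_alphaP n g :
  gen (fun g : KleinGrp => g = gpow alpha (2 ^ (n - 1))%N) g <-> KGpow n g.
Proof.
have ep : gpow alpha (2 ^ (n - 1))%N = (2 ^+ (n - 1), 0) :> KG.
  by rewrite gpow_alpha; congr pair; rewrite -natrX natz.
split.
- elim=> {g} [_ ->||x y _ [c ->] _ [d ->]|x _ [c ->]].
  + by exists 1; rewrite mul1r; exact: ep.
  + by exists 0; rewrite mul0r.
  + by exists (c + d); rewrite /= /kmul /ksign /= mulrDl.
  + by exists (- c); rewrite /= /kinv /ksign /= mulNr oppr0.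
- case=> c ->; elim: c => [|c IH|c IH].
  + rewrite mul0r; exact: (@gen_one KleinGrp).
  + have -> : (c.+1%:Z * 2 ^+ (n - 1), 0) =
      gmul (gpow alpha (2 ^ (n - 1))%N) (c%:Z * 2 ^+ (n - 1), 0) :> KleinGrp.
      rewrite ep /= /kmul /ksign /= addr0; congr pair.
      by rewrite intS mulrDl mul1r.
    by apply: gen_mul => //; apply: gen_base.
  + have -> : (- c.+1%:Z * 2 ^+ (n - 1), 0) =
      gmul (ginv (gpow alpha (2 ^ (n - 1))%N)) (- c%:Z * 2 ^+ (n - 1), 0) :> KleinGrp.
      rewrite ep /= /kmul /kinv /ksign /= addr0 oppr0; congr pair.
      by rewrite intS opprD mulrDl mulN1r.
    by apply: gen_mul => //; apply: gen_inv; apply: gen_base.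
Qed.

Lemma iter_phiA_a k : iter k phiA a2 = a2 /\ iter k phiAinv a2 = a2.
Proof. by elim: k => [|k [IH1 IH2]] //=; rewrite IH1 IH2 phiA_a phiAinv_a. Qed.

Lemma iter_phiA_b k (z := gmul (a2 : FreeGrp) a2) :
  iter k phiA b2 = gmul (ginv (gpow z k)) b2 /\ iter k phiAinv b2 = gmul (gpow z k) b2.
Proof.
elim: k => [|k [IH1 IH2]]; first by rewrite (_ : gpow z 0 = gone) // ginv1 !gmul1g.
rewrite !iterS IH1 IH2 phiA_hom phiAinv_hom (homV phiA_hom).
rewrite (hom_gpow phiA_hom) (hom_gpow phiAinv_hom) phiA_hom phiAinv_hom.
rewrite phiA_a phiAinv_a phiA_b phiAinv_b -/z; split.
  by rewrite /z gpowS; group_id.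
by rewrite /z gpowSr; group_id.
Qed.

(** These powers of alpha fix a2 and multiply b2 on the left by a power of (a2^2)^(2^(n-1)) =
    a2^(2^n), which is in N_(n+1). *)
Lemma phi_alpha_cong n g (x : FreeGrp) : (1 <= n)%N -> KGpow n g ->
  Nn n.+1 (gmul (ginv x) (phi g x)).
Proof.
move=> n1 [c ->].
apply: (hom_gen_cong _ (phi_hom _)) (FG_gen x) => s.
pose k := absz (c * 2 ^+ (n - 1)).
have -> : phi (c * 2 ^+ (n - 1), 0) s =
  iter k (if 0 <= c * 2 ^+ (n - 1) then phiA else phiAinv) s by [].
have ek : k = (2 ^ (n - 1) * `|c|)%N.
  by rewrite /k abszM mulnC; congr muln; rewrite -natrX natz.
have Nk : Nn n.+1 (gpow (gmul a2 a2) k).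
  rewrite ek gpow_mul; apply: gpow_in.
  have -> : gmul a2 a2 = gpow a2 2 by rewrite gpowS gpow1.
  rewrite -gpow_mul -expnS -subSn //.
  exact: Nn_a.
have [ea eV] := iter_phiA_a k; have [eb eVb] := iter_phiA_b k.
case=> ->; case: ifP => _; rewrite ?ea ?eV ?eb ?eVb.
- rewrite gmulVg; exact: nrm1.
- rewrite gmulVg; exact: nrm1.
- rewrite gmulA; apply: (@nrmJ _ (Nn n.+1)); exact: nrmV.
- rewrite gmulA; exact: (@nrmJ _ (Nn n.+1)).
Qed.

Definition NK n (x : P2K) : Prop := Nn n x.1 /\ KGpow n x.2.

Lemma KGpow1 n : KGpow n kone.
Proof. by exists 0; rewrite mul0r. Qed.

Lemma KGpowM n g h : KGpow n g -> KGpow n h -> KGpow n (kmul g h).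
Proof. by case=> c -> [d ->]; exists (c + d); rewrite /= /kmul /ksign /= mulrDl. Qed.

Lemma KGpowV n g : KGpow n g -> KGpow n (kinv g).
Proof. by case=> c ->; exists (- c); rewrite /= /kinv /ksign /= mulNr oppr0. Qed.

Lemma NK_gen n S x : (forall x, S x -> NK n x) -> gen S x -> NK n x.
Proof.
move=> SN; elim=> {x} [x /SN //|||].
- by split; [exact: nrm1 | exact: KGpow1].
- move=> [u g] [v h] _ [/= Nu Kg] _ [/= Nv Kh]; split; last exact: KGpowM.
  by apply: (@nrmM _ (Nn n)) => //; apply: Nn_hom => //; exact: phi_admissible.
- move=> [u g] _ [/= Nu Kg]; split; last exact: KGpowV.
  by apply: Nn_hom; [exact: phi_admissible | exact: (@nrmV _ (Nn n))].
Qed.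

(* [x, y] = (yx)^-1 (xy), and the components of this quotient are
   quotients of the components of xy and yx, up to the action. *)
Lemma NK_gcomm n (u v : FreeGrp) (g h : KG) :
  Nn n (gmul (ginv (gmul v (phi h u))) (gmul u (phi g v))) ->
  KGpow n (kmul (kinv (kmul h g)) (kmul g h)) ->
  NK n (gcomm ((u, g) : P2K) ((v, h) : P2K)).
Proof.
move=> Nuv Kgh; pose x : P2K := (u, g); pose y : P2K := (v, h).
have -> : gcomm x y = gmul (ginv (gmul y x)) (gmul x y) by group_id.
split; last exact: Kgh.
rewrite [X in Nn _ X](_ : _ = phi (kinv (kmul h g))
  (gmul (ginv (gmul v (phi h u))) (gmul u (phi g v)))).
  by apply: Nn_hom => //; exact: phi_admissible.
by rewrite phi_hom.
Qed.

(** The identity [id] splits the H-part of a commutator into the displacement of u by h, the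
    commutator [u, v] and the displacement of v by g. In the inductive step these are handled by
    [admissible_Nn], [Nn_comm] and [phi_alpha_cong] respectively. *)
Lemma lcs_sub_NK n x : (2 <= n)%N -> @lcs P2K n x -> NK n x.
Proof.
have id (u v u' v' : FreeGrp) : gmul (ginv (gmul v u')) (gmul u v') =
    gmul (ginv (gmul (ginv u) u')) (gmul (gcomm u v) (gmul (ginv v) v')) :> FreeGrp.
  by group_id.
case: n => [|[|d]] // _; elim: d x => [|d IH] x; apply: NK_gen.
  move=> _ [[u g] [[v h] [_ ->]]]; apply: NK_gcomm.
    rewrite id; apply: nrmM.
      by apply: nrmV; apply: admissible_N2; exact: phi_admissible.
    apply: nrmM; last by apply: admissible_N2; exact: phi_admissible.
    by apply: Nn_of_lcs => //; exact: lcs_comm.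
  case: g => m n; case: h => m' n'.
  (* Half the exponent of alpha in [g, h], by the parities of the exponents of beta. *)
  exists (if odd `|n|%N then (if odd `|n'|%N then m - m' else m')
          else if odd `|n'|%N then - m else 0).
  rewrite /kmul /kinv /ksign /=; congr pair; last by lia.
  rewrite abszN expr1.
  have -> : odd (absz (n' + n)) = odd `|n|%N (+) odd `|n'|%N by lia.
  by case: (odd `|n|%N); case: (odd `|n'|%N) => /=; lia.
move=> _ [[u g] [[v h] [Lx ->]]].
have [/= Nu Kg] := IH _ Lx; apply: NK_gcomm.
  rewrite id; apply: nrmM.
    by apply: nrmV; apply: admissible_Nn => //; exact: phi_admissible.
  by apply: nrmM; [exact: Nn_comm | exact: phi_alpha_cong].
(* [g, h] is g^-2 or 1, according as h inverts or centralises alpha. *)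
case: Kg => c -> ; exists (if odd `|h.2|%N then - c else 0).
case: h => m n; rewrite /kmul /kinv /ksign /=; congr pair; last by lia.
have -> : 2 ^+ (d.+3 - 1) = 2 * 2 ^+ (d.+2 - 1) :> int by rewrite !subn1 -exprS.
rewrite abszN addr0 mulrA; set t := 2 ^+ _.
by case: (odd `|n|%N); rewrite ?mul0r; lia.
Qed.

(** * Generators of P_2(K) and the opposite inclusion *)

Definition inH (u : FreeGrp) : P2K := (u, kone).
Definition inG (g : KleinGrp) : P2K := (fg_one, g).

Lemma inH_hom : is_hom inH.
Proof. by []. Qed.

Lemma inG_hom : is_hom inG.
Proof.
move=> g h; rewrite /inG /= /pmul /=; congr pair.
by apply/esym; apply: etrans (@gmul1g FreeGrp _ _) (hom1 (phi_hom g)).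
Qed.

Lemma P2K_split (x : P2K) : x = gmul (inH x.1) (inG x.2).
Proof.
case: x => u g; rewrite /= /pmul /= phi1; congr pair; last exact/esym/(@gmul1g KleinGrp).
exact/esym/(@gmulg1 FreeGrp).
Qed.

Lemma conj_a_beta : gconj (inH a2) (inG beta) = ginv (inH a2).
Proof. by rewrite /gconj /inH /inG /= /pmul /=; congr pair; apply: val_inj. Qed.

Lemma conj_b_beta : gconj (inH b2) (inG beta) = inH (gmul a2 (gmul b2 a2)).
Proof. by rewrite /gconj /inH /inG /= /pmul /=; congr pair; apply: val_inj. Qed.

Lemma conj_alpha_beta : gconj (inG alpha) (inG beta) = ginv (inG alpha).
Proof. by rewrite /gconj /inH /inG /= /pmul /=; congr pair; apply: val_inj. Qed.

Definition P2K_gens : P2K -> Prop :=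
  fun x => [\/ x = inH a2, x = inH b2, x = inG alpha | x = inG beta].

Lemma Klein_gen (g : KleinGrp) : gen (fun g => g = alpha \/ g = beta) g.
Proof.
case: g => m n.
have -> : (m, n) = gmul ((m, 0%R) : KleinGrp) ((0%R, n) : KleinGrp) :> KleinGrp.
  by rewrite /= /kmul /ksign /= addr0 add0r.
apply: gen_mul.
- elim: m => [|m IH|m IH]; first exact: (@gen_one KleinGrp).
  + have -> : (Posz m.+1, 0%R) = gmul alpha ((Posz m, 0%R) : KleinGrp) :> KleinGrp.
      by rewrite /= /kmul /ksign /= addr0 intS.
    by apply: gen_mul => //; apply: gen_base; left.
  + have -> : ((- Posz m.+1)%R, 0%R) = gmul (ginv alpha) (((- Posz m)%R, 0%R) : KleinGrp) :> KleinGrp.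
      by rewrite /= /kmul /kinv /ksign /= addr0 intS opprD.
    by apply: gen_mul => //; apply: gen_inv; apply: gen_base; left.
- elim: n {m} => [|m IH|m IH]; first exact: (@gen_one KleinGrp).
  + have -> : (0%R, Posz m.+1) = gmul beta ((0%R, Posz m) : KleinGrp) :> KleinGrp.
      by rewrite /= /kmul /ksign /= intS.
    by apply: gen_mul => //; apply: gen_base; right.
  + have -> : (0%R, (- Posz m.+1)%R) = gmul (ginv beta) ((0%R, (- Posz m)%R) : KleinGrp) :> KleinGrp.
      by rewrite /= /kmul /kinv /ksign /= intS opprD.
    by apply: gen_mul => //; apply: gen_inv; apply: gen_base; right.
Qed.

Lemma hom_gen (G G' : Grp) (LG : group_laws G) (LG' : group_laws G') (f : G -> G') S T x :
  is_hom f -> (forall s, S s -> gen T (f s)) -> gen S x -> gen T (f x).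
Proof.
move=> fM ST; elim=> {x} [x /ST //||x y _ Hx _ Hy|x _ Hx].
- rewrite (hom1 fM); exact: gen_one.
- by rewrite fM; apply: gen_mul.
- by rewrite (homV fM); apply: gen_inv.
Qed.

Lemma P2K_gen (x : P2K) : gen P2K_gens x.
Proof.
rewrite [x]P2K_split; apply: gen_mul.
- apply: (hom_gen _ _ inH_hom _ (FG_gen x.1)) => s [] ->; apply: gen_base.
    exact: Or41.
  exact: Or42.
- apply: (hom_gen _ _ inG_hom _ (Klein_gen x.2)) => s [] ->; apply: gen_base.
    exact: Or43.
  exact: Or44.
Qed.

(** Here [x, y] = x^-2. It serves for a2 and alpha, both inverted by beta. *)
Lemma sq_of_inverted (G : Grp) (LG : group_laws G) (x y : G) :
  gconj x y = ginv x -> @lcs G 2 (gmul x x).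
Proof.
move=> e.
have -> : gmul x x = ginv (gcomm x y).
  have -> : gcomm x y = gmul (ginv x) (gconj x y) by group_id.
  by rewrite e -ginvM ginvK.
by apply: nrmV; apply: lcs_comm.
Qed.

(** A pair of distinct generators containing a2 or alpha is settled by [comm_sq_of_sq]. For the
    remaining pair, [b2, beta] = [b2, a2^-1] a2^2, and a2^4 is the inverse of [a2^2, beta]. *)
Lemma P2K_comm_sq (x y : P2K) : @lcs P2K 3 (gmul (gcomm x y) (gcomm x y)).
Proof.
have La := sq_of_inverted P2K_laws conj_a_beta; have Lal := sq_of_inverted P2K_laws conj_alpha_beta.
have Lbb : @lcs P2K 3 (gmul (gcomm (inH b2) (inG beta)) (gcomm (inH b2) (inG beta))).
  have -> : gcomm (inH b2) (inG beta) =
    gmul (gcomm (inH b2) (ginv (inH a2))) (gmul (inH a2) (inH a2)).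
    have -> : gcomm (inH b2) (inG beta) =
      gmul (ginv (inH b2)) (gconj (inH b2) (inG beta)) by group_id.
    by rewrite conj_b_beta !inH_hom; group_id.
  apply: sqM; first exact: (@lcs_comm P2K 2 _ _ isT La).
    by apply: comm_sqC; apply: comm_sq_of_sq; rewrite -ginvM; apply: nrmV.
  set A := inH a2 in La *.
  have -> : gmul (gmul A A) (gmul A A) = ginv (gcomm (gmul A A) (inG beta)).
    have -> : gcomm (gmul A A) (inG beta) =
      gmul (ginv (gmul A A)) (gmul (gconj A (inG beta)) (gconj A (inG beta))) by group_id.
    by rewrite conj_a_beta -/A; group_id.
  by apply: nrmV; apply: lcs_comm.
have id1 (z : P2K) : @lcs P2K 3 (gmul (gcomm z z) (gcomm z z)).
  have -> : gcomm z z = gone by group_id.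
  by rewrite gmul1g; apply: nrm1.
apply: (comm_sq_gen P2K_gen) => s t [] -> [] ->; try exact: id1;
  try exact: comm_sq_of_sq; try exact/comm_sqC/comm_sq_of_sq; try exact: Lbb.
exact: comm_sqC.
Qed.

Lemma NK_sub_lcs n x : (2 <= n)%N -> NK n x -> @lcs P2K n x.
Proof.
move=> n2 [Nx Kx].
(* The first squaring reaches Gamma_2; each of the other n - 2 gains one term. *)
have P2 (z : P2K) : @lcs P2K 2 (gmul z z) -> @lcs P2K n (gpow z (2 ^ (n - 1))%N).
  move=> Lz; have -> : (n - 1 = 1 + (n - 2))%N by lia.
  rewrite expnD gpow_mul.
  have := @lcs_pow2 _ P2K_laws 2 (n - 2)%N _ P2K_comm_sq isT Lz.
  by rewrite subnKC // (gpow_exp2 z 0) expn0 gpow1.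
rewrite [x]P2K_split; apply: nrmM.
- move: Nx; elim=> {Kx} [_ [s [g [Ss ->]]]||u v _ Hu _ Hv|u _ Hu].
  + rewrite (hom_gconj inH_hom); apply: nrmJ.
    case: Ss => [->|[i [y [i2 [Ly ->]]]]]; rewrite (hom_gpow inH_hom).
      by apply: P2; exact: sq_of_inverted conj_a_beta.
    have := @lcs_pow2 _ P2K_laws i (n - i)%N (inH y) P2K_comm_sq.
    rewrite subnKC; last by case/andP: i2.
    by apply; [case/andP: i2 | apply: hom_lcs].
  + rewrite (hom1 inH_hom); exact: nrm1.
  + by rewrite inH_hom; apply: nrmM.
  + by rewrite (homV inH_hom); apply: nrmV.
- have /gen_alphaP := Kx; elim=> {Nx Kx x} [_ ->||u v _ Hu _ Hv|u _ Hu].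
  + rewrite (hom_gpow inG_hom); apply: P2; exact: sq_of_inverted conj_alpha_beta.
  + rewrite (hom1 inG_hom); exact: nrm1.
  + by rewrite inG_hom; apply: nrmM.
  + by rewrite (homV inG_hom); apply: nrmV.
Qed.

(** * Sanov's representation *)

Section Congruence.
Context {G : Grp} {LG : group_laws G} {R : nzRingType} (rho : G -> R).
Hypotheses (rho1 : rho gone = 1) (rhoM : forall x y, rho (gmul x y) = rho x * rho y).

(** The preimage under [rho] of the principal congruence subgroup of level 2^n. *)
Definition cong1 n (x : G) : Prop := exists m, rho x = 1 + m *+ (2 ^ n).

#[global] Instance cong1_normal n : normal (cong1 n).
Proof.
have rhoVx x : rho (ginv x) * rho x = 1 by rewrite -rhoM gmulVg.
have rhoxV x : rho x * rho (ginv x) = 1 by rewrite -rhoM gmulgV.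
split.
- by exists 0; rewrite mul0rn addr0.
- move=> x y [m em] [k ek]; exists (m + k + m * k *+ (2 ^ n)).
  rewrite rhoM em ek !mulrnDl -mulrnAl -mulrnAr.
  move: (m *+ _) (k *+ _) => m' k'.
  by rewrite mulrDl mul1r mulrDr mulr1 -!addrA [k' + _]addrCA.
- move=> x [m em]; exists (- (m * rho (ginv x))).
  rewrite -[LHS](addrK (m * rho (ginv x) *+ (2 ^ n))) -mulrnAl.
  by rewrite -{1}[rho (ginv x)]mul1r -mulrDl -em rhoxV mulrnAl mulNrn.
- move=> x g [m em]; exists (rho (ginv g) * m * rho g).
  by rewrite /gconj !rhoM em mulrDr mulr1 mulrDl rhoVx mulrnAr mulrnAl.
Qed.

(** With rho(x) = 1 + 2^n m and rho(y) = 1 + 2k, the images of xy and yx differ by 2^(n+1) (mk -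
    km); dividing by yx gives the commutator. *)
Lemma cong1_comm n x y : cong1 n x -> cong1 1 y -> cong1 n.+1 (gcomm x y).
Proof.
move=> [m em] [k ek]; exists (rho (ginv (gmul y x)) * (m * k - k * m)).
have -> : gcomm x y = gmul (ginv (gmul y x)) (gmul x y) by group_id.
have e : rho (gmul x y) = rho (gmul y x) + (m * k - k * m) *+ (2 ^ n.+1).
  have -> : (m * k - k * m) *+ (2 ^ n.+1) =
    (m *+ 2 ^ n) * (k *+ 2 ^ 1) - (k *+ 2 ^ 1) * (m *+ 2 ^ n).
    by rewrite !mulrnAl !mulrnAr -!mulrnA (mulnC (2 ^ 1)%N) -expnD addn1 mulrnBl.
  rewrite !rhoM em ek; move: (m *+ _) (k *+ _) => m' k'.
  rewrite !mulrDl !mul1r !mulrDr !mulr1 -!addrA; congr (1 + _).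
  by rewrite addrCA [k' * m' + _]addrC subrK.
rewrite rhoM e mulrDr -rhoM gmulVg rho1 mulrnAr //.
Qed.

Lemma cong1_sq n x : (0 < n)%N -> cong1 n x -> cong1 n.+1 (gmul x x).
Proof.
(* The level is now n + 1, and the square term has coefficient 2^(2(n+1)) = 2^(n+2) 2^n. *)
case: n => // n _ [m em]; exists (m + m * m *+ (2 ^ n)).
rewrite rhoM em mulrDl mul1r mulrDr mulr1 -addrA; congr (1 + _).
rewrite mulrnAr mulrnAl addrA -mulrnDr addnn -mul2n -expnS mulrnDl; congr (_ + _).
by rewrite -!mulrnA -!expnD; congr (_ *+ 2 ^ _)%R; lia.
Qed.

Lemma cong1_pow2 n k x : (0 < n)%N -> cong1 n x -> cong1 (n + k) (gpow x (2 ^ k)).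
Proof.
move=> n0 Cx; elim: k => [|k IH]; first by rewrite addn0 gpow1.
by rewrite gpow_exp2 addnS; apply: cong1_sq => //; apply: ltn_addr.
Qed.

Lemma cong1_lcs n x : (forall y, cong1 1 y) -> (0 < n)%N -> @lcs G n x -> cong1 n x.
Proof.
move=> C1; case: n => // n _; elim: n x => [|n IH] x // Lx.
by apply: gen_in Lx => _ [y [z [/IH Cy ->]]]; apply: cong1_comm.
Qed.

End Congruence.

Definition elemA (e : bool) : 'M[int]_2 :=
  \matrix_(i, j) (if i == j then 1 else if (i < j)%N then (if e then -2 else 2) else 0).
Definition elemB (e : bool) : 'M[int]_2 :=
  \matrix_(i, j) (if i == j then 1 else if (j < i)%N then (if e then -2 else 2) else 0).
Definition sanov_letter (x : letter) : 'M[int]_2 :=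
  if x.1 then elemB x.2 else elemA x.2.
Definition sanov_word (s : seq letter) : 'M[int]_2 :=
  foldr (fun x M => sanov_letter x *m M) 1%:M s.
Definition sanov (u : FreeGrp) : 'M[int]_2 := sanov_word (sval u).

Lemma sanov_letterV x : sanov_letter x *m sanov_letter (inv_l x) = 1%:M.
Proof.
case: x => [[] []]; apply/matrixP => i j; rewrite !mxE !big_ord_recl big_ord0;
  case: i => [[|[|//]] ?]; case: j => [[|[|//]] ?]; by rewrite !mxE.
Qed.

Lemma sanov_cons_red x s : sanov_word (cons_red x s) = sanov_letter x *m sanov_word s.
Proof.
case: s => [|y s] //=; case: eqP => [->|//] /=.
by rewrite mulmxA sanov_letterV mul1mx.
Qed.

Lemma sanovM (u v : FreeGrp) : sanov (gmul u v) = sanov u * sanov v.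
Proof.
rewrite /sanov /=; elim: (sval u) => [|x s IH] /=; first by rewrite mul1r.
by rewrite sanov_cons_red IH; exact: mulmxA.
Qed.

Lemma sanov1 : sanov gone = 1. Proof. by []. Qed.

Lemma sanov_cong1 u : cong1 sanov 1 u.
Proof.
have I := cong1_normal sanov1 sanovM 1.
apply: gen_in (FG_gen u) => s [] ->.
- exists (delta_mx 0 1); rewrite /sanov /= mulmx1.
  apply/matrixP => i j; rewrite !mxE mulrS ?mxE;
  case: i => [[|[|//]] ?]; case: j => [[|[|//]] ?]; by [].
- exists (delta_mx 1 0); rewrite /sanov /= mulmx1.
  apply/matrixP => i j; rewrite !mxE;
  case: i => [[|[|//]] ?]; case: j => [[|[|//]] ?]; by [].
Qed.

(** Each squaring raises the level by one, starting from level 1 for a2 and level i for Gamma_i. *)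
Lemma Nn_cong1 n u : (2 <= n)%N -> Nn n u -> cong1 sanov n u.
Proof.
move=> n2; have I := cong1_normal sanov1 sanovM n.
apply: normal_closure_in => _ [->|[i [x [i2 [Lx ->]]]]].
  have -> : n = (1 + (n - 1))%N by lia.
  rewrite addKn; apply: (cong1_pow2 sanovM) => //; exact: sanov_cong1.
have [i0 en] : (0 < i)%N /\ n = (i + (n - i))%N by lia.
rewrite {1}en; apply: (cong1_pow2 sanovM) => //.
apply: (cong1_lcs sanov1 sanovM) => //; exact: sanov_cong1.
Qed.

Definition mxact (M : 'M[int]_2) (v : int * int) : int * int :=
  (M 0 0 * v.1 + M 0 1 * v.2, M 1 0 * v.1 + M 1 1 * v.2).

Lemma mxactM M N v : mxact (M *m N) v = mxact M (mxact N v).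
Proof.
rewrite /mxact !mxE !big_ord_recl !big_ord0 /=.
have -> : lift ord0 ord0 = 1 :> 'I_2 by apply: val_inj.
by congr pair; ring.
Qed.

(* The ping-pong domain of the letter [x]. *)
Definition region (x : letter) (v : int * int) : bool :=
  let p := if x.1 then v.2 else v.1 in
  let q := if x.1 then v.1 else v.2 in
  let q' := if x.2 then - q else q in
  (0 < q' < p) || (p < q' < 0).

Lemma mxact_letter x v : mxact (sanov_letter x) v =
  let c : int := if x.2 then -2 else 2 in
  if x.1 then (v.1, c * v.1 + v.2) else (v.1 + c * v.2, v.2).
Proof.
by case: x => [[] []]; rewrite /mxact /sanov_letter !mxE /=; congr pair; ring.
Qed.

Lemma region_step x y v : y != inv_l x -> region y v ->
  region x (mxact (sanov_letter x) v).
Proof.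
rewrite mxact_letter /region.
by case: v => p q; case: x => [[] []]; case: y => [[] []] //= _; lia.
Qed.

(** The start vector lies on an axis, outside every region. The last letter moves it into its own
    region, and reducedness lets each earlier letter apply [region_step]. The equation on v is kept
    to contradict a trivial action. *)
Lemma sanov_pingpong s x : reduced (x :: s) ->
  exists v, v.1 * v.2 = 0 /\ region x (mxact (sanov_word (x :: s)) v).
Proof.
elim: s x => [|y s IH] x.
  move=> _; exists (if x.1 then (1, 0) else (0, 1)); split; first by case: x.1.
  by rewrite /sanov_word /= mulmx1 mxact_letter; case: x => [[] []].
move=> /andP[ne /IH[v [v0 vy]]]; exists v; split=> //.
by rewrite [sanov_word _]/= mxactM; apply: region_step vy.
Qed.

Lemma sanov_inj u : sanov u = 1 -> u = gone.
Proof.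
case: u => [[|x s] rs]; first by move=> _; apply: val_inj.
have [v [v0 vx]] := sanov_pingpong rs => e; exfalso; move: vx.
have -> : sanov_word (x :: s) = 1 by exact: e.
rewrite /mxact !mxE /= !mul1r !mul0r addr0 add0r.
case: v v0 {e} => p q /= pq; rewrite /region.
by case: (x) => [[] []] /=; nia.
Qed.

(** * Trivial intersections and the conclusion *)

Lemma pow2_divisible_eq0 (z : int) :
  (forall n, exists m, z = m * 2 ^+ n.+1) -> z = 0.
Proof.
(* The instance n = |z| suffices, since 2^(|z|+1) exceeds |z|. *)
move=> H; have [m em] := H `|z|%N; apply/eqP; rewrite -absz_eq0.
have : (`|z| < 2 ^ `|z|.+1)%N by apply: ltn_trans (ltnSn _) (ltn_expl _ _).
have {em} : (`|z| = `|m| * 2 ^ `|z|.+1)%N by rewrite {1}em abszM abszX.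
by case: (absz m) => [|k]; [move->; rewrite mul0n | rewrite mulSn; lia].
Qed.

Lemma Nn_inter_trivial u : (forall n, Nn n.+2 u) -> u = fg_one.
Proof.
move=> Nu; apply: sanov_inj; apply/matrixP => i j.
apply/eqP; rewrite -subr_eq0; apply/eqP.
apply: pow2_divisible_eq0 => n; have [m ->] := @Nn_cong1 n.+2 _ isT (Nu n).
(* Level n + 2 has one factor 2 more than the power 2^(n+1) asked for. *)
exists (m i j *+ 2); rewrite [fun_of_matrix (1 + _) _ _]mxE addrC addrK mulmxnE.
by rewrite -[LHS]mulr_natr natrX exprS mulrA mulr_natr.
Qed.

Lemma KGpow_inter_trivial g : (forall n, KGpow n.+2 g) -> g = kone.
Proof.
move=> Kg; have [c eg] := Kg 0%N; rewrite [g]surjective_pairing {2}eg.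
congr pair; apply: pow2_divisible_eq0 => n.
by have [d ->] := Kg n; exists d; rewrite subn1.
Qed.

Local Close Scope ring_scope.

Theorem theorem5p3 :
  (forall n : nat, (2 <= n)%N ->
     forall x : P2K,
       @lcs P2K n x <->
       (Nn n x.1 /\ gen (fun g : KleinGrp => g = gpow alpha (2 ^ (n - 1))) x.2))
  /\ residually_nilpotent P2K.
Proof.
have NKP n x : 2 <= n -> @lcs P2K n x <-> NK n x.
  by move=> n2; split; [apply: lcs_sub_NK | apply: NK_sub_lcs].
split=> [n n2 x|x Lx].
  apply: iff_trans (NKP n x n2) _.
  by split=> -[Nx Kx]; split=> //; apply/gen_alphaP.
have {}Lx n : NK n.+2 x by apply/NKP.
rewrite [x]surjective_pairing; congr pair.
  by apply: Nn_inter_trivial => n; have [] := Lx n.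
by apply: KGpow_inter_trivial => n; have [] := Lx n.
Qed.
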